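(* Let $[\widehat{0},\widehat{1}]$ be a graded dual simplicial Eulerian poset of rank $n+1$ and let $(h_0,\ldots,h_n)$ be the toric $h$-vector of $(\widehat{0},\widehat{1}]^*$. Then $$ \operatorname{t}([\widehat{0},\widehat{1}),x)=h_0 t_n(x)+\sum_{i=1}^{\left\lfloor n/2\right\rfloor} (h_i-h_{i-1}) \sum_{k=1}^{\min\{i,n-i\}} \frac{n+1-2i}{k}\binom{n-i}{k-1}\binom{i-1}{k-1}\, t_{n-2k}(x). $$
   Context: A graded poset is a finite poset with a unique minimum $\widehat{0}$, a unique maximum $\widehat{1}$ and a rank function $\rho:P\to\mathbb{N}$ with $\rho(\widehat{0})=0$ and $\rho(y)=\rho(x)+1$ whenever $y$ covers $x$; its rank is $\rho(\widehat{1})$. It is Eulerian if $\sum_{z\in[u,v]}(-1)^{\rho(z)}=0$ for all $u<v$. It is dual simplicial if for every $t\neq\widehat{0}$ the interval $[t,\widehat{1}]$ is a Boolean algebra. $Q^*$ denotes the dual (order-reversed) poset of $Q$. Write $[\widehat{0},p)=\{q: q<p\}$ and $(\widehat{0},\widehat{1}]=[\widehat{0},\widehat{1}]\setminus\{\widehat{0}\}$. Stanley's toric polynomials: $f(\emptyset,x)=g(\emptyset,x)=1$ ($\emptyset$ being $[\widehat{0},\widehat{1})$ for the Eulerian poset of rank $0$), and for an Eulerian poset of rank at least $1$, $$f([\widehat{0},\widehat{1}),x)=\sum_{p\in[\widehat{0},\widehat{1})} g([\widehat{0},p),x)(x-1)^{\rho(\widehat{1})-1-\rho(p)},$$ $$g([\widehat{0},\widehat{1}),x)=\sum_{i=0}^{\lfloor(\rho(\widehat{1})-1)/2\rfloor}\left([x^i]f([\widehat{0},\widehat{1}),x)-[x^{i-1}]f([\widehat{0},\widehat{1}),x)\right)x^i.$$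 By a theorem of Stanley, if the rank is $n+1$ then $f([\widehat{0},\widehat{1}),x)$ has degree $n$ and satisfies $x^nf([\widehat{0},\widehat{1}),1/x)=f([\widehat{0},\widehat{1}),x)$. Toric $h$-vector: for an Eulerian poset $Q$ of rank $n+1$, the toric $h$-vector $(h_0,\dots,h_n)$ of $Q\setminus\{\widehat{1}_Q\}$ is defined by $\sum_i h_ix^i=x^nf(Q\setminus\{\widehat{1}_Q\},1/x)$ (which equals $f(Q\setminus\{\widehat{1}_Q\},x)$). Here it is applied to $Q=[\widehat{0},\widehat{1}]^*$, whose maximum is $\widehat{0}$. Short toric polynomial: for an Eulerian poset of rank $n+1$, $\operatorname{t}([\widehat{0},\widehat{1}),x)$ is the unique polynomial $q(x)$ of degree $n$ with $q(x)=(-1)^nq(-x)$ and $f([\widehat{0},\widehat{1}),x)=x^{n/2}\left(q(\sqrt{x})+q(1/\sqrt{x})-q(0)\right)$; equivalently, it is obtained from $x^{n}f([\widehat{0},\widehat{1}),x^{-2})$ by discarding all terms of negative degree. $t_m(x)$ denotes the short toric polynomial of the Boolean algebra of rank $m+1$ (with its maximum removed); explicitly $t_m(x)=\sum_{k=0}^{\lfloor m/2\rfloor}x^{m-2k}$ for $m\geq0$. *)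

(* Defs.v *)
From HB Require Import structures.
From mathcomp Require Import all_boot all_order all_algebra zify.

Set Implicit Arguments.
Unset Strict Implicit.
Unset Printing Implicit Defensive.

Import Order.TTheory GRing.Theory Num.Theory Order.DefaultSetSubsetOrder.
Local Open Scope ring_scope.

(* An Eulerian poset [0^, 1^] is carried by a finite type T with bottom and top
   together with its rank function rho : T -> nat. *)

Definition covers (d : Order.disp_t) (T : finTBPOrderType d) (x y : T) : bool :=
  (x < y)%O && [forall z : T, ~~ ((x < z)%O && (z < y)%O)].

Definition rank_function (d : Order.disp_t) (T : finTBPOrderType d)
    (rho : T -> nat) : Prop :=
  rho \bot%O = 0%N /\ forall x y : T, covers x y -> rho y = (rho x).+1.

Definition eulerian (d : Order.disp_t) (T : finTBPOrderType d)
    (rho : T -> nat) : Prop :=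
  forall u v : T, (u < v)%O ->
    \sum_(z : T | (u <= z <= v)%O) (-1) ^+ rho z = 0 :> int.

Definition boolean_interval (d : Order.disp_t) (T : finTBPOrderType d)
    (u v : T) : Prop :=
  exists (k : nat) (phi : {set 'I_k} -> T),
    (forall A B, (phi A <= phi B)%O = (A \subset B)) /\
    (forall x, (u <= x <= v)%O <-> exists A, phi A = x).

Definition dual_simplicial (d : Order.disp_t) (T : finTBPOrderType d) : Prop :=
  forall t : T, t != \bot%O -> boolean_interval t \top%O.

(* g from f, for an Eulerian poset of rank r; for r = 0 it sends 1 to 1. *)
Definition toric_trunc (r : nat) (f : {poly rat}) : {poly rat} :=
  \poly_(i < (r.-1)./2.+1) (f`_i - (if i is j.+1 then f`_j else 0)).

(* The first argument is recursion fuel: the number of elements below p is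
   enough, see toric_f_recE. *)
Fixpoint toric_f_rec (k : nat) (d : Order.disp_t) (T : finTBPOrderType d)
    (rho : T -> nat) (p : T) : {poly rat} :=
  if p == \bot%O then 1 else
  if k is k'.+1 then
    \sum_(q : T | (q < p)%O)
      toric_trunc (rho q) (toric_f_rec k' rho q)
        * ('X - 1) ^+ ((rho p).-1 - rho q)
  else 0.

(* toric_f rho p and toric_g rho p are f([0^, p), x) and g([0^, p), x). *)
Definition toric_f (d : Order.disp_t) (T : finTBPOrderType d)
    (rho : T -> nat) (p : T) : {poly rat} :=
  toric_f_rec #|[pred q : T | (q < p)%O]| rho p.

Definition toric_g (d : Order.disp_t) (T : finTBPOrderType d)
    (rho : T -> nat) (p : T) : {poly rat} :=
  toric_trunc (rho p) (toric_f rho p).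

Lemma toric_f_recE (d : Order.disp_t) (T : finTBPOrderType d)
    (rho : T -> nat) (k : nat) (p : T) :
  (#|[pred q : T | (q < p)%O]| <= k)%N -> toric_f_rec k rho p = toric_f rho p.
Proof.
have ltc (x y : T) : (x < y)%O ->
    (#|[pred q : T | (q < x)%O]| < #|[pred q : T | (q < y)%O]|)%N.
  move=> xy; apply: proper_card; apply/properP; split.
    by apply/subsetP=> z; rewrite !inE => /lt_trans; apply.
  by exists x; rewrite !inE ?ltxx.
suff H m : forall k l (p : T), (#|[pred q : T | (q < p)%O]| <= m)%N ->
    (#|[pred q : T | (q < p)%O]| <= k)%N ->
    (#|[pred q : T | (q < p)%O]| <= l)%N ->
    toric_f_rec k rho p = toric_f_rec l rho p.
  by move=> hk; apply: (H k).
elim: m => [|m IHm] {}k l {}p hm hk hl.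
  case: k hk => [|k] hk; case: l hl => [|l] hl //=;
    case: eqP => // /eqP; rewrite -lt0x => /ltc;
    by move=> /leq_trans/(_ hm); rewrite ltn0.
case: (eqVneq p \bot%O) => [->|pn0]; first by case: k {hk} => [|k]; case: l {hl} => [|l] /=; rewrite eqxx.
have c0 : (0 < #|[pred q : T | (q < p)%O]|)%N.
  by apply/card_gt0P; exists \bot%O; rewrite inE lt0x.
case: k hk => [|k] hk; first by move: (leq_trans c0 hk).
case: l hl => [|l] hl; first by move: (leq_trans c0 hl).
rewrite /= (negPf pn0); apply: eq_bigr => q /ltc qp.
by rewrite (IHm k l) // -ltnS; apply: leq_trans qp _.
Qed.

Lemma toric_f0 (d : Order.disp_t) (T : finTBPOrderType d) (rho : T -> nat) :
  toric_f rho \bot%O = 1.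
Proof. by rewrite /toric_f; case: #|_| => [|k] /=; rewrite eqxx. Qed.

Lemma toric_g0 (d : Order.disp_t) (T : finTBPOrderType d) (rho : T -> nat) :
  rho \bot%O = 0%N -> toric_g rho \bot%O = 1.
Proof.
rewrite /toric_g toric_f0 => ->; apply/polyP=> i.
by rewrite coef_poly coef1; case: i => [|i] //=; rewrite ?subr0 ?coef1.
Qed.

Lemma toric_fE (d : Order.disp_t) (T : finTBPOrderType d) (rho : T -> nat)
    (p : T) : p != \bot%O ->
  toric_f rho p =
  \sum_(q : T | (q < p)%O) toric_g rho q * ('X - 1) ^+ ((rho p).-1 - rho q).
Proof.
move=> pn0; rewrite -(@toric_f_recE _ _ rho #|[pred q : T | (q < p)%O]|.+1) //=.
rewrite (negPf pn0); apply: eq_bigr => q qp; rewrite toric_f_recE //.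
by apply: subset_leq_card; apply/subsetP=> z; rewrite !inE => /lt_trans; apply.
Qed.

(* For a poset of rank n + 1, the polynomial x^n f(1/x); its coefficients are
   h_0, ..., h_n. *)
Definition toric_h (d : Order.disp_t) (T : finTBPOrderType d)
    (rho : T -> nat) : {poly rat} :=
  \poly_(i < rho \top%O) (toric_f rho \top%O)`_((rho \top%O).-1 - i).

Definition dual_rank (d : Order.disp_t) (T : finTBPOrderType d)
    (rho : T -> nat) : T^d -> nat :=
  fun x => (rho \top%O - rho (x : T))%N.

(* The terms of nonnegative degree of x^n f(x^{-2}). *)
Definition short_of_toric (n : nat) (f : {poly rat}) : {poly rat} :=
  \sum_(i < size f | (2 * i <= n)%N) f`_i *: 'X^(n - 2 * i).

Definition short_toric (d : Order.disp_t) (T : finTBPOrderType d)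
    (rho : T -> nat) : {poly rat} :=
  short_of_toric (rho \top%O).-1 (toric_f rho \top%O).

(* The last clause is f(x) = x^{n/2} (q(x^{1/2}) + q(x^{-1/2}) - q(0)) after
   replacing x by x^2. *)
Definition short_toric_spec (n : nat) (f q : {poly rat}) : Prop :=
  [/\ size q = n.+1,
      q = (-1) ^+ n *: (q \Po - 'X) &
      f \Po 'X^2 = 'X^n * q + \sum_(j < n.+1) q`_j *: 'X^(n - j)
                   - q`_0 *: 'X^n].

(* The degree and symmetry hypotheses hold for toric polynomials of Eulerian
   posets by a theorem of Stanley. *)
Lemma short_toric_specP (n : nat) (f q : {poly rat}) :
  size f = n.+1 -> (forall i, (i <= n)%N -> f`_(n - i) = f`_i) ->
  short_toric_spec n f q <-> q = short_of_toric n f.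
Proof.
move=> sf fsym; set F := f \Po 'X^2; set s := short_of_toric n f.
have cF m : F`_m = if (2 %| m)%N then f`_(m %/ 2) else 0.
  by rewrite coef_comp_poly_Xn.
have Fsym j : (j <= n)%N -> F`_(n + j) = F`_(n - j).
  move=> jn; rewrite !cF; have -> : (n + j = n - j + j * 2)%N by lia.
  rewrite dvdn_addl ?dvdn_mull //; case: ifP => // /dvdnP[i ij].
  rewrite ij -mulnDl !mulnK // -[in RHS]fsym; last by lia.
  by congr (f`_ _); lia.
have Fbig m : (2 * n < m)%N -> F`_m = 0.
  by move=> nm; rewrite cF; case: ifP => // /dvdnP[i mi]; rewrite nth_default //;
    rewrite mi mulnK // sf; lia.
have cs j : s`_j = F`_(n + j).
  rewrite /s /short_of_toric coef_sum.
  have [jn|nj] := leqP j n; last first.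
    rewrite Fbig; last by lia.
    rewrite big1 // => i _; rewrite coefZ coefXn.
    by case: eqP => [|_]; [lia | rewrite mulr0].
  rewrite Fsym // cF; case: ifP => [/dvdnP[i ij]|nd].
    have lt_i : (i < size f)%N by rewrite sf; lia.
    rewrite (bigD1 (Ordinal lt_i)) /=; last by lia.
    rewrite coefZ coefXn (_ : (j == _) = true) ?mulr1; last by apply/eqP; lia.
    rewrite big1 ?addr0 ?ij ?mulnK // => k /andP[k2 kn].
    rewrite coefZ coefXn; case: eqP => [jk|_]; last by rewrite mulr0.
    by case/eqP: kn; apply: val_inj => /=; lia.
  rewrite big1 // => i i2; rewrite coefZ coefXn.
  case: eqP => [jk|_]; last by rewrite mulr0.
  by move: nd; rewrite jk subKn // dvdn_mulr.
have cq (q' : {poly rat}) m :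
    ('X^n * q' + \sum_(j < n.+1) q'`_j *: 'X^(n - j) - q'`_0 *: 'X^n)`_m
    = if (n <= m)%N then q'`_(m - n) else q'`_(n - m).
  rewrite coefB coefD coefXnM coef_sum coefZ coefXn.
  have -> : \sum_(j < n.+1) (q'`_j *: 'X^(n - j))`_m
     = if (m <= n)%N then q'`_(n - m) else 0.
    case: leqP => mn; last first.
      rewrite big1 // => j _; rewrite coefZ coefXn.
      by case: eqP => [|_]; [lia | rewrite mulr0].
    have lt_j : (n - m < n.+1)%N by lia.
    rewrite (bigD1 (Ordinal lt_j)) //= coefZ coefXn subKn // eqxx mulr1.
    rewrite big1 ?addr0 // => k kn; rewrite coefZ coefXn.
    case: eqP => [mk|_]; last by rewrite mulr0.
    by case/eqP: kn; apply: val_inj => /=; have := ltn_ord k; lia.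
  case: ltngtP => [nm|mn|->].
  - by rewrite mulr0 subr0 add0r.
  - by rewrite mulr0 subr0 addr0.
  - by rewrite subnn mulr1 addrK.
split=> [[_ _ Fq]|->].
  apply/polyP=> j; rewrite cs /F Fq cq leq_addr; congr (_`_ _); lia.
have sn : s`_n != 0.
  rewrite cs Fsym // subnn cF dvdn0 div0n -fsym // subn0.
  by have := lead_coef_eq0 f; rewrite /lead_coef sf /= -size_poly_eq0 sf => ->.
split.
- apply/eqP; rewrite eqn_leq; apply/andP; split.
    by apply/leq_sizeP=> j nj; rewrite cs Fbig //; lia.
  by rewrite ltnNge; apply: contraNN sn => sz; rewrite nth_default.
- apply/polyP=> j; rewrite coefZ coef_comp_poly.
  have cN i : ((- 'X : {poly rat}) ^+ i)`_j = (-1) ^+ i * (j == i)%:R.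
    by rewrite -scaleN1r exprZn coefZ coefXn.
  have -> : \sum_(i < size s) s`_i * ((- 'X) ^+ i)`_j = (-1) ^+ j * s`_j.
    have [sj|js] := leqP (size s) j.
      rewrite [s`_j]nth_default // mulr0 big1 // => i _.
      rewrite cN; have := ltn_ord i.
      by case: eqP => [|_]; [lia | rewrite !mulr0].
    rewrite (bigD1 (Ordinal js)) //= cN eqxx mulr1 mulrC.
    rewrite big1 ?addr0 // => i ij; rewrite cN.
    have /negPf -> : j != i by apply: contraNneq ij => ji; apply/eqP/val_inj.
    by rewrite !mulr0.
  rewrite mulrA -exprD cs cF; case: ifP => [nj|_]; last by rewrite mulr0.
  by rewrite -signr_odd; move: nj; rewrite dvdn2 => /negPf ->; rewrite mul1r.
apply/polyP=> m; rewrite cq !cs; have [nm|mn] := leqP n m.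
  by congr (_`_ _); lia.
by rewrite Fsym; [congr (_`_ _); lia | lia].
Qed.

(* {set 'I_m} is ordered by inclusion. *)
Definition boolean_rank (m : nat) (A : {set 'I_m}) : nat := #|A|.

Definition boolean_short_toric (m : nat) : {poly rat} :=
  short_toric (@boolean_rank m.+1).

(* Main.v *)
Require Import Defs.
From HB Require Import structures.
From mathcomp Require Import all_boot all_order all_algebra.
From mathcomp Require Import zify ring.

(** The formula says that g of the poset is [sum_i (h_i - h_{i-1}) N_i] with
    [N_0 = 1] and [N_i] the inner sum with [t_{n-2k}] replaced by [x^k]. A
    family [g_p] with [2 deg g_p < rho(p)] is the toric g if and only if, for
    all [p],
    [sum_(q <= p) g_q (x-1)^(rho(p) - rho(q)) = x^rho(p) g_p(1/x)].

    Set [N(n+1-i, i) = N_i], extended antisymmetrically. In a dual simplicial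
    poset all g's of the dual are 1, so [(x-1) f] of the dual interval below [q]
    is [sum_(0 < s <= q) (x-1)^rho(s)], and the candidate for [g_q] is half the
    image of the homogenisation [sum_s (y-w)^rho(s) w^(rho(q)-rho(s))] under
    [y^a w^b |-> N(a, b)]. Since [[s, p]] is Boolean, summing over [q] amounts to
    the substitution [y -> y+x-1], [w -> w+x-1], which fixes [y - w]; the
    identity thus reduces to one about the binomial transform of [N], where both
    sides satisfy the same three-term recurrence. *)

Set Implicit Arguments.
Unset Strict Implicit.
Unset Printing Implicit Defensive.

Import Order.TTheory GRing.Theory Num.Theory Order.DefaultSetSubsetOrder.
Local Open Scope ring_scope.

(** * Narayana-type polynomials [nar] and their recurrence *)

(** The coefficient of [z^d] in [(z / (1 - z))^k]. *)
Fixpoint comp_coef (d k : nat) : rat :=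
  match d, k with
  | 0, 0 => 1
  | 0, _.+1 => 0
  | _.+1, 0 => 0
  | d'.+1, k'.+1 => comp_coef d' k'.+1 + comp_coef d' k'
  end.

Lemma comp_coefS (d k : nat) : comp_coef d.+1 k.+1 = 'C(d, k)%:R.
Proof.
elim: d k => [|d IHd] k; first by case: k.
rewrite [LHS](_ : _ = comp_coef d.+1 k.+1 + comp_coef d.+1 k) // IHd.
by case: k => [|k]; rewrite ?IHd -?natrD // !bin0 addr0.
Qed.

Lemma comp_coef_small (d k : nat) : (d < k)%N -> comp_coef d k = 0.
Proof. by case: d k => [|d] [|k] //; rewrite comp_coefS ltnS => /bin_small->. Qed.

(** With [Z = z / (1 - z)] and [V = v / (1 - v)], the generating function
    [sum_(a, b) nar a b z^a v^b] is
    [(1 / (1 - z) - 1 / (1 - v)) / (1 - X Z V)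
     = (z - v) / ((1 - z) (1 - v) - X z v)]. *)
Definition nar_coef (a b k : nat) : rat :=
  comp_coef a k.+1 * comp_coef b k - comp_coef a k * comp_coef b k.+1.

Definition nar (a b : nat) : {poly rat} := \poly_(k < (a + b).+1) nar_coef a b k.

(** If [a = b] the two products cancel; otherwise the smaller index is below [k] and kills both.
    This is the degree bound required of a toric g. *)
Lemma nar_coef_small (a b k : nat) : (a + b <= 2 * k)%N -> nar_coef a b k = 0.
Proof.
move=> abk; have [abE|ab] := eqVneq a b; first by rewrite /nar_coef abE mulrC subrr.
rewrite /nar_coef; have [ak|ka] := ltnP a k.
  by rewrite !(comp_coef_small _ : comp_coef a _ = 0) ?mul0r ?subr0 //; lia.
by rewrite !(comp_coef_small _ : comp_coef b _ = 0) ?mulr0 ?subr0 //; lia.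
Qed.

Lemma coef_nar (a b k : nat) : (nar a b)`_k = nar_coef a b k.
Proof.
rewrite coef_poly; case: leqP => // abk; rewrite nar_coef_small //; lia.
Qed.

Lemma nar_coef_sym (a b k : nat) : nar_coef b a k = - nar_coef a b k.
Proof. by rewrite /nar_coef opprB mulrC [X in _ - X]mulrC. Qed.

Lemma nar_sym (a b : nat) : nar b a = - nar a b.
Proof. by apply/polyP=> k; rewrite coefN !coef_nar nar_coef_sym. Qed.

Lemma nar0 (a : nat) : nar a.+1 0 = 1.
Proof.
apply/polyP=> k; rewrite coef_nar coef1 /nar_coef.
case: k => [|k]; rewrite !comp_coefS /= ?mulr0 ?subr0 ?mulr1 //.
by rewrite bin0.
Qed.

Lemma nar00 : nar 0 0 = 0.
Proof. by apply/polyP=> k; rewrite coef_nar coef0 nar_coef_small. Qed.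

(** By the absorption rule [H], [k] cancels from the difference. For [a = n - i] and [b = i - 1] the
    factor [a - b] is [n + 1 - 2i]. *)
Lemma nar_coefE (a b k : nat) :
  nar_coef a.+1 b.+1 k.+1
  = (a%:R - b%:R) / k.+1%:R * 'C(a, k)%:R * 'C(b, k)%:R.
Proof.
rewrite /nar_coef !comp_coefS; apply: (mulfI (x := k.+1%:R)); first by rewrite pnatr_eq0.
have H (m : nat) : k.+1%:R * 'C(m, k.+1)%:R = (m%:R - k%:R) * 'C(m, k)%:R :> rat.
  have [mk|km] := ltnP m k; first by rewrite !bin_small ?mulr0 //; lia.
  by rewrite -natrB // -!natrM mul_bin_left.
rewrite mulrBr mulrA H mulrCA H; field; by rewrite addrC natr1 pnatr_eq0.
Qed.

(** Reads off the denominator [(1 - z)(1 - v) - X z v]; the numerator [z - v] has no term divisible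
    by [z v]. *)
Lemma narSS (a b : nat) :
  nar a.+1 b.+1 = nar a.+1 b + nar a b.+1 + ('X - 1) * nar a b.
Proof.
apply/polyP=> k; rewrite mulrBl mul1r !coefD coefN coefXM !coef_nar /nar_coef.
by case: k => [|k] /=; ring.
Qed.

(** * Reversal of polynomials and antisymmetric differences *)

Definition poly_rev (R : nzRingType) (m : nat) (p : {poly R}) : {poly R} :=
  \poly_(j < m.+1) p`_(m - j).

Lemma poly_revD (R : nzRingType) (m : nat) : {morph @poly_rev R m : p q / p + q}.
Proof.
by move=> p q; apply/polyP=> j; rewrite coefD !coef_poly coefD; case: ifP; rewrite ?addr0.
Qed.

Lemma poly_revZ (R : nzRingType) (m : nat) (c : R) : {morph @poly_rev R m : p / c *: p}.
Proof.
by move=> p; apply/polyP=> j; rewrite coefZ !coef_poly coefZ; case: ifP; rewrite ?mulr0.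
Qed.

Lemma poly_revN (R : nzRingType) (m : nat) : {morph @poly_rev R m : p / - p}.
Proof. by move=> p; rewrite -scaleN1r poly_revZ scaleN1r. Qed.

Lemma poly_rev0 (R : nzRingType) (m : nat) : poly_rev m (0 : {poly R}) = 0.
Proof. by rewrite -[X in poly_rev _ X](scale0r 0) poly_revZ scale0r. Qed.

Lemma poly_revS (R : nzRingType) (m : nat) (p : {poly R}) :
  p`_m.+1 = 0 -> poly_rev m.+1 p = 'X * poly_rev m p.
Proof.
move=> p0; apply/polyP=> -[|j]; rewrite coefXM /= !coef_poly ?subn0 //.
Qed.

Lemma poly_revMX (R : nzRingType) (m : nat) (p : {poly R}) :
  poly_rev m.+1 ('X * p) = poly_rev m p.
Proof.
apply/polyP=> j; rewrite !coef_poly coefXM.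
have [jm|mj] := leqP j m; first by rewrite !ltnS leqW // jm subSn.
rewrite !ltnS (leqNgt j m) mj /=; case: leqP => // jm.
by rewrite (_ : m.+1 - j = 0)%N //; apply/eqP; rewrite subn_eq0.
Qed.

Lemma poly_rev1 (R : nzRingType) (m : nat) : poly_rev m 1 = 'X^m :> {poly R}.
Proof.
apply/polyP=> j; rewrite coef_poly coefXn coef1 ltnS subn_eq0.
by case: (ltngtP j m).
Qed.

(** Under the linear map sending [y^a w^b] to [F a b], this is multiplication by [y - w]. *)
Definition adiff (V : zmodType) (F : nat -> nat -> V) (a b : nat) : V :=
  F a.+1 b - F a b.+1.

Definition rnar (a b : nat) := poly_rev (a + b) (nar a b).

Lemma rnarSS (a b : nat) :
  rnar a.+1 b.+1 = 'X * (rnar a.+1 b + rnar a b.+1) - 'X * ('X - 1) * rnar a b.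
Proof.
have s0 c d m : (c + d <= m)%N -> (nar c d)`_m = 0.
  by move=> cdm; rewrite coef_nar nar_coef_small //; lia.
rewrite /rnar narSS mulrBl mul1r !poly_revD poly_revN.
rewrite !addSn !addnS.
rewrite poly_revMX !poly_revS ?s0 //; try lia; ring.
Qed.

(** * Binomial transforms of two-index arrays, applied to [nar] *)

(** [bintrans e F a b = sum_(c, d) 'C(a, c) 'C(b, d) e^(a + b - c - d) F c d],
    defined by Pascal's rule so that it visibly commutes with shifts. *)
Fixpoint bintrans1 (R : comNzRingType) (e : R) (F : nat -> R) (b : nat) : R :=
  if b is b'.+1 then e * bintrans1 e F b' + bintrans1 e (fun j => F j.+1) b' else F 0%N.

Fixpoint bintrans (R : comNzRingType) (e : R) (F : nat -> nat -> R) (a b : nat) : R :=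
  if a is a'.+1 then e * bintrans e F a' b + bintrans e (fun i => F i.+1) a' b
  else bintrans1 e (F 0%N) b.

Lemma bintransS (R : comNzRingType) (e : R) F (a b : nat) :
  bintrans e F a b.+1 = e * bintrans e F a b + bintrans e (fun i j => F i j.+1) a b.
Proof. by elim: a F => [|a IHa] F //=; rewrite !IHa; ring. Qed.

Lemma bintrans_lin (R : comNzRingType) (e c d : R) F1 F2 F (a b : nat) :
  (forall i j, F i j = c * F1 i j + d * F2 i j) ->
  bintrans e F a b = c * bintrans e F1 a b + d * bintrans e F2 a b.
Proof.
elim: a b F F1 F2 => [|a IHa] b F F1 F2 E /=; last first.
  by rewrite (IHa _ _ _ _ E) (IHa _ _ _ _ (fun i => E i.+1)); ring.
move: (F 0%N) (F1 0%N) (F2 0%N) (E 0%N) => {E}F {}F1 {}F2.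
elim: b F F1 F2 => [|b IHb] F F1 F2 E //=.
by rewrite (IHb _ _ _ E) (IHb _ _ _ (fun j => E j.+1)); ring.
Qed.

(** The transform is the substitution [y -> y + e], [w -> w + e], which fixes [y - w]. *)
Lemma bintrans_adiff (R : comNzRingType) (e : R) F (a b : nat) :
  adiff (bintrans e F) a b = bintrans e (adiff F) a b.
Proof.
rewrite (@bintrans_lin _ e 1 (-1) (fun i => F i.+1) (fun i j => F i j.+1) (adiff F)).
  by rewrite /adiff bintransS /=; ring.
by move=> i j; rewrite /adiff; ring.
Qed.

Lemma bintrans_iter_adiff (R : comNzRingType) (e : R) F r (a b : nat) :
  iter r (@adiff _) (bintrans e F) a b = bintrans e (iter r (@adiff _) F) a b.
Proof.
by elim: r a b => [|r IHr] a b //=; rewrite -bintrans_adiff /adiff !IHr.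
Qed.

Lemma bintrans_tr (R : comNzRingType) (e : R) F (a b : nat) :
  bintrans e (fun i j => F j i) a b = bintrans e F b a.
Proof.
elim: a F => [|a IHa] F; last by rewrite bintransS -!IHa.
by elim: b F => [|b IHb] F //; rewrite bintransS /= -!IHb.
Qed.

Lemma bintrans0 (R : comNzRingType) (e : R) F (b : nat) :
  bintrans e F 0 b = \sum_(j < b.+1) F 0%N j * e ^+ (b - j) *+ 'C(b, j).
Proof.
rewrite /=; move: (F 0%N) => {}F.
elim: b F => [|b IHb] F; first by rewrite big_ord1 /= mulr1.
rewrite /= !IHb [RHS]big_ord_recl bin0 mulr1n subn0.
under [X in _ = _ + X]eq_bigr => i _ do rewrite lift0 subSS binS mulrnDr.
rewrite big_split /= addrA; congr (_ + _).
rewrite [in RHS]big_ord_recr /= (bin_small (ltnSn b)) mulr0n addr0.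
rewrite mulr_sumr big_ord_recl bin0 subn0 /= mulr1n.
rewrite exprS; congr (_ + _); first by ring.
apply: eq_bigr => i _; rewrite -(subnSK (ltn_ord i)) exprS /bump add1n;
  ring.
Qed.

(** In shift operators, [narSS] reads [Y W = Y + W + e] with [e = X - 1]; replacing [Y], [W] by
    [Y - e], [W - e] gives the same relation as [rnarSS]. *)
Lemma bintrans_narSS a b (L := bintrans ('X - 1) nar) :
  L a.+1 b.+1 = 'X * (L a.+1 b + L a b.+1) - 'X * ('X - 1) * L a b.
Proof.
rewrite /L; set e := 'X - 1.
have E := @bintrans_lin _ e 1 1
  (fun i j => nar i.+1 j + nar i j.+1) (fun i j => e * nar i j)
  (fun i j => nar i.+1 j.+1) a b (fun i j => ltac:(by rewrite /= narSS -/e; ring)).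
have E1 := @bintrans_lin _ e 1 1 (fun i j => nar i.+1 j) (fun i j => nar i j.+1)
  (fun i j => nar i.+1 j + nar i j.+1) a b (fun i j => ltac:(by move=> /=; ring)).
have E2 := @bintrans_lin _ e e 0 nar nar
  (fun i j => e * nar i j) a b (fun i j => ltac:(by move=> /=; ring)).
rewrite /= !bintransS E E1 E2 /e; ring.
Qed.

(** The contribution of the bottom element to the Kazhdan-Lusztig-Stanley
    identity, transported to the index pairs [(a, b)]. *)
Definition bdry (a b : nat) : {poly rat} :=
  ('X - 1) ^+ (a + b) * ((b == 0)%:R - (a == 0)%:R).

Lemma bdrySS a b : bdry a.+1 b.+1 =
  'X * (bdry a.+1 b + bdry a b.+1) - 'X * ('X - 1) * bdry a b.
Proof.
rewrite /bdry !addSn !addnS !exprS.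
by case: a b => [|a] [|b] /=; ring.
Qed.

(** Both sides obey one recurrence, so only the edges matter: [a = 0] is the binomial expansion of a
    power of [(X - 1) + 1], and [b = 0] follows by antisymmetry. *)
Lemma bintrans_nar a b : bintrans ('X - 1) nar a b + bdry a b = rnar a b.
Proof.
have H m : bintrans ('X - 1) nar 0 m + bdry 0 m = rnar 0 m.
  rewrite bintrans0 /bdry /rnar add0n eqxx.
  case: m => [|m].
    by rewrite big_ord1 nar00 mul0r mul0rn subrr mulr0 addr0 poly_rev0.
  rewrite big_ord_recl nar00 mul0r mul0rn add0r sub0r mulrN1.
  rewrite nar_sym nar0 poly_revN poly_rev1.
  have -> : 'X^(m.+1) = ('X - 1 + 1) ^+ m.+1 :> {poly rat} by rewrite subrK.
  rewrite [in RHS]exprDn [in RHS]big_ord_recl bin0 mulr1n subn0 expr1n mulr1 opprD addrC.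
  congr (_ + _); rewrite -sumrN; apply: eq_bigr => i _.
  by rewrite nar_sym nar0 expr1n mulr1 mulN1r mulNrn.
elim: a b => [|a IHa] b; first exact: H.
elim: b => [|b IHb].
  rewrite -bintrans_tr (@bintrans_lin _ _ (-1) 0 nar nar (fun i j => nar j i));
    last by move=> i j; rewrite nar_sym; ring.
  have := H a.+1; rewrite /rnar addn0 nar_sym poly_revN add0n /bdry addn0 add0n /=.
  by move=> /(canRL (addrK _)) ->; ring.
by rewrite bintrans_narSS rnarSS -!IHa -IHb bdrySS; ring.
Qed.

(** * Iterated differences of [nar] *)

Lemma coef_iter_adiff_nar r a b k :
  (a + b + r <= 2 * k)%N -> (iter r (@adiff _) nar a b)`_k = 0.
Proof.
elim: r a b => [|r IHr] a b /= abk.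
  by rewrite coef_nar nar_coef_small //; lia.
by rewrite /adiff coefB !IHr ?subrr //; lia.
Qed.

Lemma iter_adiff_rnar r a b :
  iter r (@adiff _) rnar a b = poly_rev (a + b + r) (iter r (@adiff _) nar a b).
Proof.
elim: r a b => [|r IHr] a b /=; first by rewrite addn0.
by rewrite /adiff !IHr poly_revD poly_revN !addnS !addSn.
Qed.

Lemma iter_adiff_bdry r a b : iter r (@adiff _) bdry a b =
  ('X - 1) ^+ (a + b + r) * ((b == 0)%:R - (-1) ^+ r * (a == 0)%:R).
Proof.
elim: r a b => [|r IHr] a b /=; first by rewrite addn0 mul1r.
by rewrite /adiff !IHr !addnS !addSn !exprS /=; ring.
Qed.

Lemma bintrans_iter_adiff_nar r b :
  bintrans ('X - 1) (iter r (@adiff _) nar) 0 b =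
  poly_rev (b + r) (iter r (@adiff _) nar 0%N b)
  - ('X - 1) ^+ (b + r) * ((b == 0)%:R - (-1) ^+ r).
Proof.
have H a c : iter r (@adiff _) (bintrans ('X - 1) nar) a c
    = iter r (@adiff _) rnar a c - iter r (@adiff _) bdry a c.
  elim: r a c => [|r IHr] a c /=; first by rewrite -bintrans_nar addrK.
  have step F : adiff F a c = F a.+1 c - F a c.+1 :> {poly rat} by [].
  by rewrite !step !IHr; ring.
by rewrite -bintrans_iter_adiff H iter_adiff_rnar iter_adiff_bdry mulr1.
Qed.

(** Expands [(y - w)^r w^b], whose coefficients are those of [(X - 1)^r]. *)
Lemma iter_adiff_coef (V : lmodType rat) (F : nat -> nat -> V) r b :
  iter r (@adiff _) F 0%N b =
  \sum_(i < (r + b).+1) (('X - 1) ^+ r)`_i *: F i (r + b - i)%N.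
Proof.
elim: r F => [|r IHr] F.
  rewrite big_ord_recl /= subn0 coef1 scale1r big1 ?addr0 // => i _.
  by rewrite coef1 /= scale0r.
rewrite iterSr IHr addSn.
set p := _ ^+ r; have p0 : p`_(r + b).+1 = 0.
  by rewrite nth_default // size_exp_XsubC; lia.
have -> : ('X - 1) ^+ r.+1 = ('X - 1) * p by rewrite exprS.
under [RHS]eq_bigr => i _ do rewrite mulrBl mul1r coefB scalerBl.
rewrite sumrB [in RHS]big_ord_recl coefXM scale0r add0r.
rewrite [X in _ = _ - X]big_ord_recr /= p0 scale0r addr0.
rewrite -sumrB; apply: eq_bigr => i _.
by rewrite coefXM /bump add1n subSS -scalerBr /adiff subSn // -ltnS.
Qed.

(** * Ranks and Boolean upper intervals *)

Section Poset.
Variables (d : Order.disp_t) (T : finTBPOrderType d) (rho : T -> nat).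

Lemma rank_lt (hrank : rank_function rho) (x y : T) :
  (x < y)%O -> (rho x < rho y)%N.
Proof.
case: hrank => _ hc.
have [m] := ubnP #|[pred z : T | (x < z < y)%O]|.
elim: m x y => // m IHm x y; rewrite ltnS => cm xy.
have [/hc -> //|] := boolP (covers x y).
rewrite /covers xy /= negb_forall => /existsP[z]; rewrite negbK => /andP[xz zy].
have H u v : (x <= u)%O -> (v <= y)%O -> ~~ (u < z < v)%O ->
    (#|[pred t : T | (u < t < v)%O]| < m)%N.
  move=> xu vy nz; apply: leq_trans cm; apply: proper_card; apply/properP; split.
    apply/subsetP=> t; rewrite !inE => /andP[ut tv].
    by rewrite (le_lt_trans xu ut) (lt_le_trans tv vy).
  by exists z; rewrite !inE ?xz ?zy.
apply: (@ltn_trans (rho z)); apply: IHm => //; apply: H => //;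
  by rewrite ?ltxx ?andbF // ltW.
Qed.

Lemma rank_le (hrank : rank_function rho) (x y : T) :
  (x <= y)%O -> (rho x <= rho y)%N.
Proof. by rewrite le_eqVlt => /orP[/eqP->//|/(rank_lt hrank)/ltnW]. Qed.

(** Removing one element from [A] gives an element covered by [phi A]; induct on [#|A|]. *)
Lemma boolean_interval_rank (hrank : rank_function rho) (u : T) k
    (phi : {set 'I_k} -> T) :
  (forall A B, (phi A <= phi B)%O = (A \subset B)) ->
  (forall x, (u <= x <= \top)%O <-> exists A, phi A = x) ->
  forall A, rho (phi A) = (rho u + #|A|)%N.
Proof.
move=> mono surj.
have inj : injective phi.
  by move=> A B AB; apply/eqP; rewrite eqEsubset -!mono AB lexx.
have phi0 : phi set0 = u.
  apply/le_anti; have [|A uA] := proj1 (surj u); first by rewrite lexx lex1.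
  rewrite -{1}uA mono sub0set.
  by have /andP[] := proj2 (surj (phi set0)) (ex_intro _ set0 erefl).
move=> A; have [m] := ubnP #|A|; elim: m A => // m IHm A; rewrite ltnS => cA.
have [->|/set0Pn[i iA]] := eqVneq A set0; first by rewrite phi0 cards0 addn0.
have cAi := cardsD1 i A; rewrite iA add1n in cAi.
rewrite cAi addnS -IHm; last by rewrite -cAi.
apply: hrank.2; rewrite /covers lt_def mono subD1set.
have -> /= : phi A != phi (A :\ i).
  by apply/eqP=> /inj AE; move: iA; rewrite AE !inE eqxx.
apply/forallP=> z; apply/negP=> /andP[Az zA].
have [|B Bz] := proj1 (surj z).
  have /andP[+ _] := proj2 (surj (phi (A :\ i))) (ex_intro _ _ erefl).
  by move=> /le_trans/(_ (ltW Az)) ->; rewrite lex1.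
move: (ltW Az) (ltW zA); rewrite -Bz !mono => AB BA.
have [iB|iB] := boolP (i \in B).
  suff AE : A = B by move: zA; rewrite -Bz AE ltxx.
  apply/eqP; rewrite eqEsubset BA andbT; apply/subsetP=> j jA.
  by have [->//|ji] := eqVneq j i; apply: (subsetP AB); rewrite !inE ji.
suff AE : A :\ i = B by move: Az; rewrite -Bz AE ltxx.
by apply/eqP; rewrite eqEsubset AB subsetD1 BA.
Qed.

Lemma sum_subset (V : nmodType) (I : finType) (B : {set I}) (F : nat -> V) :
  \sum_(A : {set I} | A \subset B) F #|A| = \sum_(j < #|B|.+1) F j *+ 'C(#|B|, j).
Proof.
rewrite (partition_big (fun A : {set I} => inord #|A| : 'I_#|B|.+1) predT) //=.
apply: eq_bigr => j _; rewrite -[X in _ *+ X]cards_draws -sumr_const.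
apply: congr_big => // [A|A /andP[AB /eqP<-]].
  rewrite inE; case: (boolP (A \subset B)) => //= /subset_leq_card AB.
  by rewrite -val_eqE /= inordK.
by rewrite inordK // ltnS subset_leq_card.
Qed.

Lemma sum_upper_interval (hrank : rank_function rho) (hds : dual_simplicial T)
    (V : nmodType) (u v : T) (F : nat -> V) : u != \bot%O -> (u <= v)%O ->
  \sum_(z : T | (u <= z <= v)%O) F (rho z) =
  \sum_(j < (rho v - rho u).+1) F (rho u + j)%N *+ 'C(rho v - rho u, j).
Proof.
move=> u0 uv; have [k [phi [mono surj]]] := hds u u0.
have rk := boolean_interval_rank hrank mono surj.
have inj : injective phi.
  by move=> A B AB; apply/eqP; rewrite eqEsubset -!mono AB lexx.
have [|B Bv] := proj1 (surj v); first by rewrite uv lex1.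
rewrite -Bv rk addKn -(sum_subset B (fun j => F (rho u + j)%N)).
rewrite (reindex_omap phi (fun z => [pick A | phi A == z])) /=; last first.
  move=> z /andP[uz _]; have [|A Az] := proj1 (surj z); first by rewrite uz lex1.
  by case: pickP => [A' /= /eqP ->//|/(_ A)]; rewrite Az eqxx.
apply: congr_big => // [A|A _]; last by rewrite rk.
rewrite mono; have /andP[-> _] := proj2 (surj (phi A)) (ex_intro _ A erefl).
case: pickP => [A' /= /eqP/inj ->|/(_ A)]; rewrite eqxx // ?andbT //.
Qed.

End Poset.

(** * The Kazhdan-Lusztig-Stanley characterization of the toric g *)

Lemma poly_rev_XsubC1 m r : (r <= m)%N ->
  poly_rev m (('X - 1) ^+ r) = (1 - 'X) ^+ r * 'X^(m - r) :> {poly rat}.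
Proof.
elim: r m => [|r IHr] m rm.
  by rewrite !expr0 poly_rev1 subn0 mul1r.
case: m rm => // m rm; rewrite exprS mulrBl mul1r poly_revD poly_revN poly_revMX.
rewrite poly_revS; last by rewrite nth_default // size_exp_XsubC.
by rewrite IHr // subSS exprS; ring.
Qed.

(** In degrees below [m / 2] the reversed [G] vanishes by the degree bound, so there the
    coefficients of [G] are the successive differences of those of [f]. *)
Lemma toric_trunc_kls m (f G : {poly rat}) : (0 < m)%N ->
  ('X - 1) * f + G = poly_rev m G -> (forall k, (m <= 2 * k)%N -> G`_k = 0) ->
  toric_trunc m f = G.
Proof.
move=> m0 fG G0; apply/polyP=> i; rewrite coef_poly ltnS.
case: leqP => im; last by rewrite G0 //; lia.
have : (('X - 1) * f + G)`_i = 0.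
  by rewrite fG coef_poly; case: ifP => // _; apply: G0; lia.
rewrite coefD mulrBl mul1r coefB coefXM => /eqP; rewrite addr_eq0 => /eqP.
by case: i im => [|i] _ /=; rewrite ?sub0r ?subr0 => /eqP;
  rewrite -eqr_oppLR ?opprB ?opprK => /eqP.
Qed.

Lemma exprXn_sub1 m :
  'X^m = \sum_(i < m.+1) ('X - 1) ^+ (m - i) *+ 'C(m, i) :> {poly rat}.
Proof.
rewrite -[LHS]/('X ^+ m) -{1}(subrK 1 'X) exprDn.
by apply: eq_bigr => i _; rewrite expr1n mulr1.
Qed.

Section Kls.
Variables (d : Order.disp_t) (T : finTBPOrderType d) (rho : T -> nat).
Hypothesis rho_lt : forall x y, (x < y)%O -> (rho x < rho y)%N.

Lemma mul_toric_f p : p != \bot%O -> ('X - 1) * toric_f rho p =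
  \sum_(q : T | (q < p)%O) toric_g rho q * ('X - 1) ^+ (rho p - rho q).
Proof.
move=> p0; rewrite toric_fE // mulr_sumr; apply: eq_bigr => q /rho_lt qp.
have -> : (rho p - rho q = ((rho p).-1 - rho q).+1)%N by lia.
by rewrite exprS mulrCA.
Qed.

Hypothesis rho_bot : rho \bot%O = 0%N.

(** Induction on rank: the summand [z = q] is [G q], the others form [(X - 1) f] by induction, and
    [toric_trunc_kls] applies. *)
Lemma toric_g_unique (G : T -> {poly rat}) (p : T) : G \bot%O = 1 ->
  (forall q, (q <= p)%O -> q != \bot%O ->
     forall k, (rho q <= 2 * k)%N -> (G q)`_k = 0) ->
  (forall q, (q <= p)%O -> q != \bot%O ->
     \sum_(z : T | (z <= q)%O) G z * ('X - 1) ^+ (rho q - rho z)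
     = poly_rev (rho q) (G q)) ->
  toric_g rho p = G p.
Proof.
move=> Gbot Gdeg Grev.
have [m] := ubnP (rho p); elim: m {-2}p (lexx p) => // m IHm q qp; rewrite ltnS => qm.
have [->|q0] := eqVneq q \bot%O; first by rewrite toric_g0.
apply: toric_trunc_kls; last 1 first.
- exact: Gdeg.
- by rewrite -rho_bot rho_lt // lt0x.
rewrite mul_toric_f // -Grev // [RHS](bigD1 q) //= subnn mulr1 addrC; congr (_ + _).
apply: eq_big => [z|z zq]; first by rewrite lt_neqAle andbC.
rewrite IHm //; first exact: le_trans (ltW zq) qp.
exact: leq_trans (rho_lt zq) qm.
Qed.

Lemma toric_simplicial p :
  (forall q, (q <= p)%O ->
     \sum_(z : T | (z <= q)%O) ('X - 1) ^+ (rho q - rho z)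
     = 'X^(rho q) :> {poly rat}) ->
  toric_g rho p = 1.
Proof.
move=> H; apply: (@toric_g_unique (fun=> 1)) => // q qp q0.
  move=> k; rewrite coef1; case: k => // /[!muln0]; rewrite leqNgt.
  by rewrite -[X in (X < _)%N]rho_bot rho_lt // lt0x.
by rewrite poly_rev1 -H //; apply: eq_bigr => z _; rewrite mul1r.
Qed.

End Kls.

(** * Boolean algebras and the short toric polynomial *)

Lemma boolean_rank_top m : boolean_rank (\top%O : {set 'I_m}) = m.
Proof. by rewrite /boolean_rank cardsT card_ord. Qed.

Lemma toric_f_boolean m :
  toric_f (@boolean_rank m.+1) \top%O = \sum_(i < m.+1) 'X^i.
Proof.
have lt (A B : {set 'I_m.+1}) : (A < B)%O -> (boolean_rank A < boolean_rank B)%N.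
  by move=> AB; apply: proper_card; rewrite properEneq -lt_neqAle.
have sumE (B : {set 'I_m.+1}) :
    \sum_(A : {set 'I_m.+1} | (A <= B)%O)
      ('X - 1) ^+ (boolean_rank B - boolean_rank A)
    = 'X^(boolean_rank B) :> {poly rat}.
  rewrite (sum_subset B (fun j => ('X - 1) ^+ (#|B| - j))).
  by rewrite -exprXn_sub1.
have b0 : boolean_rank (\bot%O : {set 'I_m.+1}) = 0%N by exact: cards0.
have g1 A : toric_g (@boolean_rank m.+1) A = 1.
  by apply: toric_simplicial => // q _; apply: sumE.
have rt := boolean_rank_top m.+1.
have tb : (\top%O : {set 'I_m.+1}) != \bot%O.
  by apply/eqP=> tb; move: rt; rewrite tb b0.
have x1 : ('X - 1 : {poly rat}) != 0 by rewrite polyXsubC_eq0.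
apply: (mulfI x1); rewrite -subrX1 mul_toric_f //.
rewrite -[X in 'X^X]rt -sumE [in RHS](bigD1 \top%O) ?lexx //= subnn addrC addrK.
apply: eq_big => [A|A _]; first by rewrite lt_neqAle andbC.
by rewrite g1 mul1r.
Qed.

Lemma short_of_toricE n (f : {poly rat}) :
  short_of_toric n f = \sum_(i < n./2.+1) f`_i *: 'X^(n - 2 * i).
Proof.
rewrite /short_of_toric.
rewrite -(big_mkord (fun i => 2 * i <= n)%N (fun i => f`_i *: 'X^(n - 2 * i))).
rewrite -(big_mkord xpredT (fun i => f`_i *: 'X^(n - 2 * i))).
rewrite [LHS](@big_nat_widen _ _ _ _ _ (maxn (size f) n./2.+1)) ?leq_maxl //.
rewrite [RHS](@big_nat_widen _ _ _ _ _ (maxn (size f) n./2.+1)) ?leq_maxr //.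
rewrite big_mkcond [RHS]big_mkcond; apply: eq_bigr => i _ /=.
have -> : (i < n./2.+1)%N = (2 * i <= n)%N by lia.
case: (ltnP i (size f)) => fi; rewrite ?andbT ?andbF //.
by rewrite nth_default // scale0r if_same.
Qed.

Lemma boolean_short_toricE m :
  boolean_short_toric m = \sum_(i < m./2.+1) 'X^(m - 2 * i).
Proof.
rewrite /boolean_short_toric /short_toric toric_f_boolean boolean_rank_top.
rewrite -[m.+1.-1]/m short_of_toricE; apply: eq_bigr => i _.
have im : (i < m.+1)%N by have := ltn_ord i; lia.
rewrite coef_sum (bigD1 (Ordinal im)) //= coefXn eqxx big1 ?addr0 ?scale1r // => j ji.
by rewrite coefXn; case: eqP => // ij; case/eqP: ji; apply: val_inj.
Qed.

(** The coefficient of index [j] in [G] enters those of [f] with index [i >= j]; the powers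
    [X^(n - 2i)] for these [i] add up to the Boolean polynomial of index [n - 2j]. *)
Lemma short_of_toric_g n (f G : {poly rat}) :
  (forall i, (i <= n./2)%N -> f`_i = \sum_(j < i.+1) G`_j) ->
  short_of_toric n f = \sum_(j < n./2.+1) G`_j *: boolean_short_toric (n - 2 * j).
Proof.
move=> fG; rewrite short_of_toricE.
transitivity (\sum_(i < n./2.+1) \sum_(j < n./2.+1 | (j <= i)%N)
   G`_j *: 'X^(n - 2 * i) : {poly rat}).
  apply: eq_bigr => i _; have ii : (i <= n./2)%N by rewrite -ltnS.
  rewrite (fG i ii) scaler_suml.
  by rewrite (@big_ord_widen _ _ _ i.+1 n./2.+1
    (fun j => G`_j *: 'X^(n - 2 * i)) (ltn_ord i)).
rewrite (exchange_big_dep predT) //=; apply: eq_bigr => j _.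
rewrite -scaler_sumr boolean_short_toricE; congr (_ *: _).
have jn := ltn_ord j.
have -> : (n - 2 * j)./2.+1 = (n./2.+1 - j)%N by lia.
rewrite -(big_mkord (fun i => (j <= i)%N) (fun i => 'X^(n - 2 * i))).
transitivity (\sum_(j <= i < n./2.+1) 'X^(n - 2 * i) : {poly rat}).
  by rewrite [RHS](big_nat_widenl _ 0).
rewrite -{1}[nat_of_ord j]add0n big_addn big_mkord; apply: eq_bigr => i _.
by rewrite mulnDr subnDA subnAC.
Qed.

Lemma toric_f_sum_g m (f : {poly rat}) i : (i <= m.-1./2)%N ->
  f`_i = \sum_(j < i.+1) (toric_trunc m f)`_j.
Proof.
elim: i => [|i IHi] im.
  by rewrite big_ord1 coef_poly /= subr0.
by rewrite big_ord_recr /= -IHi ?(ltnW im) // coef_poly ltnS im addrC subrK.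
Qed.

(** * The toric g of a dual simplicial Eulerian poset *)

Section DualSimplicial.
Variables (d : Order.disp_t) (T : finTBPOrderType d) (rho : T -> nat).
Hypotheses (hrank : rank_function rho) (heul : eulerian rho)
  (hds : dual_simplicial T).

Lemma sum_sign_rank (R : nzRingType) (p : T) : p != \bot%O ->
  \sum_(s : T | (s != \bot%O) && (s <= p)%O) (-1) ^+ rho s = -1 :> R.
Proof.
rewrite -lt0x => p0; have /(congr1 (fun x => x%:~R : R)) := heul p0.
rewrite (bigD1 \bot%O) /=; last by rewrite lexx le0x.
rewrite hrank.1 expr0 rmorphD rmorph_sum /= => /eqP; rewrite addrC addr_eq0 => /eqP E.
rewrite -[RHS]E.
apply: eq_big => [s|s _]; first by rewrite le0x andbC.
by rewrite rmorphXn /= rmorphN1.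
Qed.

Lemma sum_upper_pow (u v : T) : u != \bot%O -> (u <= v)%O ->
  \sum_(z : T | (u <= z <= v)%O) ('X - 1) ^+ (rho z - rho u)
  = 'X^(rho v - rho u) :> {poly rat}.
Proof.
move=> u0 uv; rewrite (sum_upper_interval hrank hds (fun m => ('X - 1) ^+ (m - rho u))) //.
rewrite -[RHS]/('X ^+ _) -{2}(subrK 1 'X) exprD1n.
by apply: eq_bigr => i _; rewrite addKn.
Qed.

(** [adiff^r nar 0 k] is the image of [(y - w)^r w^k] under the linear map
    [y^a w^b |-> nar a b]. The factor 1/2 compensates for the antisymmetry of
    [nar]. *)
Definition toric_g_ds (p : T) : {poly rat} :=
  if p == \bot%O then 1 else
  2^-1 *: \sum_(s : T | (s != \bot%O) && (s <= p)%O)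
    iter (rho s) (@adiff _) nar 0%N (rho p - rho s)%N.

Lemma coef_toric_g_ds p k : p != \bot%O -> (rho p <= 2 * k)%N -> (toric_g_ds p)`_k = 0.
Proof.
move=> p0 pk; rewrite /toric_g_ds (negPf p0) coefZ coef_sum big1 ?mulr0 // => s /andP[_ sp].
by apply: coef_iter_adiff_nar; rewrite add0n subnK // rank_le.
Qed.

(** Summing over the Boolean interval [[s, p]] is a binomial transform, which
    commutes with [adiff]; so the identity reduces to [bintrans_nar]. *)
Lemma toric_g_ds_rev p : p != \bot%O ->
  \sum_(z : T | (z <= p)%O) toric_g_ds z * ('X - 1) ^+ (rho p - rho z)
  = poly_rev (rho p) (toric_g_ds p).
Proof.
move=> p0; set e := 'X - 1.
rewrite (bigD1 \bot%O) ?le0x //= {1}/toric_g_ds eqxx mul1r hrank.1 subn0.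
rewrite {2}/toric_g_ds (negPf p0) poly_revZ.
rewrite (big_morph _ (@poly_revD _ _) (@poly_rev0 _ _)).
have two : (2%:R : rat) != 0 by [].
transitivity (e ^+ rho p + 2^-1 *: \sum_(s : T | (s != \bot%O) && (s <= p)%O)
    bintrans e (iter (rho s) (@adiff _) nar) 0 (rho p - rho s)).
  congr (_ + _).
  transitivity (2^-1 *: \sum_(z : T | (z <= p)%O && (z != \bot%O))
     \sum_(s : T | (s != \bot%O) && (s <= z)%O)
      iter (rho s) (@adiff _) nar 0%N (rho z - rho s)%N * e ^+ (rho p - rho z)).
    rewrite scaler_sumr; apply: eq_bigr => z /andP[_ z0].
    by rewrite /toric_g_ds (negPf z0) -scalerAl mulr_suml.
  congr (_ *: _).
  (* With [s] outermost, the inner sum runs over the Boolean interval from [s] to [p]. *)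
  rewrite (exchange_big_dep (fun s => (s != \bot%O) && (s <= p)%O)); last first.
    by move=> z s /= /andP[zp _] /andP[-> sz]; rewrite (le_trans sz zp).
  apply: eq_bigr => s /andP[s0 sp].
  rewrite bintrans0 (eq_bigl (fun z => (s <= z <= p)%O)); last first.
    move=> z; rewrite s0 /=; case: (boolP (s <= z)%O) => [sz|]; rewrite ?andbF // andbT.
    suff -> : z != \bot%O by rewrite andbT.
    by apply: contraNneq s0 => z0; move: sz; rewrite z0 lex0.
  rewrite (sum_upper_interval hrank hds
    (fun m => iter (rho s) (@adiff _) nar 0%N (m - rho s)%N * e ^+ (rho p - m))) //.
  by apply: eq_bigr => j _; rewrite addKn subnDA.
transitivity (e ^+ rho p + 2^-1 *: (\sum_(s : T | (s != \bot%O) && (s <= p)%O)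
    poly_rev (rho p) (iter (rho s) (@adiff _) nar 0%N (rho p - rho s)%N)
    - e ^+ rho p * \sum_(s : T | (s != \bot%O) && (s <= p)%O)
      ((s == p)%:R - (-1) ^+ rho s))).
  congr (_ + _ *: _); rewrite mulr_sumr -sumrB; apply: eq_bigr => s /andP[s0 sp].
  rewrite bintrans_iter_adiff_nar subnK ?rank_le //; congr (_ - _ * (_%:R - _)).
  move: sp; rewrite le_eqVlt => /orP[/eqP->|sp]; first by rewrite subnn !eqxx.
  by rewrite (lt_eqF sp) subn_eq0 leqNgt (rank_lt hrank sp).
(* The diagonal gives [1] and the Eulerian relation another [1]. Halved, this [2] cancels the power
   [(X - 1)^(rho p)] contributed by the bottom element. *)
have -> : \sum_(s : T | (s != \bot%O) && (s <= p)%O)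
    ((s == p)%:R - (-1) ^+ rho s) = 2%:R :> {poly rat}.
  rewrite sumrB sum_sign_rank // (bigD1 p) /= ?p0 ?lexx // eqxx big1 => [|s].
    by rewrite addr0 opprK.
  by move=> /andP[_ /negPf ->].
rewrite scalerBr mulr_natr -scaler_nat scalerA mulVf // scale1r.
by rewrite addrC subrK.
Qed.

Lemma toric_g_dsE p : toric_g rho p = toric_g_ds p.
Proof.
apply: toric_g_unique => //.
- by move=> x y; apply: rank_lt.
- exact: hrank.1.
- by rewrite /toric_g_ds eqxx.
- by move=> q _ q0 k; apply: coef_toric_g_ds.
- by move=> q _; apply: toric_g_ds_rev.
Qed.

Definition rank_poly : {poly rat} := \sum_(s : T | s != \bot%O) ('X - 1) ^+ rho s.

(** The Dehn-Sommerville equations of the dual poset: by [mul_toric_f_dual],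
    [rank_poly = (X - 1) * sum_i h_i X^(n - i)]. *)
Lemma rank_poly_sym : poly_rev (rho \top%O) rank_poly = - rank_poly.
Proof.
rewrite /rank_poly (big_morph _ (@poly_revD _ _) (@poly_rev0 _ _)).
(* Reversal leaves a power of [X], which the Boolean interval above [s] expands; the Eulerian
   relation then sums out [s]. *)
transitivity (\sum_(s : T | s != \bot%O) \sum_(t : T | (s <= t)%O)
   (-1) ^+ rho s * ('X - 1) ^+ rho t : {poly rat}).
  apply: eq_bigr => s s0; rewrite poly_rev_XsubC1; last by rewrite rank_le ?lex1.
  rewrite -sum_upper_pow ?lex1 // mulr_sumr.
  apply: eq_big => [t|t /andP[st _]]; first by rewrite lex1 andbT.
  have -> : 1 - 'X = -1 * ('X - 1) :> {poly rat} by ring.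
  by rewrite exprMn -mulrA -exprD subnKC // rank_le.
rewrite (exchange_big_dep (fun t => t != \bot%O)) /=; last first.
  by move=> s t s0 st; apply: contraNneq s0 => t0; move: st; rewrite t0 lex0.
rewrite -sumrN; apply: eq_bigr => t t0.
by rewrite -mulr_suml sum_sign_rank // mulN1r.
Qed.

(** By [rank_poly_sym] and the antisymmetry of [nar], the terms at [i] and [n + 1 - i] agree, which
    absorbs the factor 1/2. *)
Lemma toric_g_top n : rho \top%O = n.+1 ->
  toric_g rho \top%O = \sum_(i < n./2.+1) rank_poly`_(n.+1 - i) *: nar (n.+1 - i) i.
Proof.
move=> hn; rewrite toric_g_dsE /toric_g_ds.
have -> : (\top%O : T) == \bot%O = false.
  by apply/eqP=> tb; move: hn; rewrite tb hrank.1.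
pose F i := rank_poly`_i *: nar i (n.+1 - i).
have -> : \sum_(s : T | (s != \bot%O) && (s <= \top)%O)
    iter (rho s) (@adiff _) nar 0%N (rho \top%O - rho s)%N = \sum_(i < n.+2) F i.
  under [RHS]eq_bigr => i _ do rewrite /F coef_sum scaler_suml.
  rewrite exchange_big /=; apply: eq_big => [s|s _]; first by rewrite lex1 andbT.
  by rewrite iter_adiff_coef subnKC ?rank_le ?lex1 // hn.
have Fsym i : (i <= n.+1)%N -> F (n.+1 - i)%N = F i.
  move=> i_n; rewrite /F subKn // nar_sym scalerN -scaleNr; congr (_ *: _).
  have := congr1 (fun p : {poly rat} => p`_i) rank_poly_sym.
  by rewrite /= hn coef_poly ltnS i_n coefN => ->; rewrite opprK.
(* For [n + 1] even the middle term has no partner, but it vanishes by antisymmetry. *)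
have Fmid i : (2 * i = n.+1)%N -> F i = 0.
  move=> i_n; rewrite /F; have -> : (n.+1 - i = i)%N by lia.
  have -> : nar i i = 0; last by rewrite scaler0.
  by apply/polyP=> k; rewrite coef_nar /nar_coef coef0 mulrC subrr.
have -> : \sum_(i < n.+2) F i = 2%:R *: \sum_(i < n./2.+1) F i.
  rewrite scaler_nat mulr2n (@big_ord_widen _ _ _ n./2.+1 n.+2 F); last by lia.
  rewrite (bigID (fun i : 'I_n.+2 => i < n./2.+1)%N) /=; congr (_ + _).
  rewrite (reindex_inj rev_ord_inj) /= [LHS]big_mkcond [RHS]big_mkcond /=.
  apply: eq_bigr => i _; rewrite subSS; have := ltn_ord i => i_n.
  case: ifP => h1; case: ifP => h2 //; rewrite ?Fsym //; first by apply: Fmid; lia.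
  by lia.
rewrite scalerA mulVf // scale1r; apply: eq_bigr => i _.
by rewrite -Fsym /F ?subKn //; have := ltn_ord i; lia.
Qed.

End DualSimplicial.

(** * The toric h-vector of the dual poset *)

Section Dual.
Variables (d : Order.disp_t) (T : finTBPOrderType d) (rho : T -> nat).
Hypotheses (hrank : rank_function rho) (hds : dual_simplicial T).

Lemma dual_rank_top : dual_rank rho \top%O = rho \top%O.
Proof. by rewrite /dual_rank -[\top%O : T^d]/(\bot%O : T) hrank.1 subn0. Qed.

(** In the dual, the interval below any element other than the maximum is Boolean, so every g in the
    sum is [1]. *)
Lemma mul_toric_f_dual : (0 < rho \top%O)%N ->
  ('X - 1) * toric_f (dual_rank rho) \top%O = rank_poly rho.
Proof.
move=> rt0; have b_neq_t : (\bot%O : T) != \top%O.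
  by apply/eqP=> tb; move: rt0; rewrite -tb hrank.1.
have b0 : dual_rank rho \bot%O = 0%N.
  by rewrite /dual_rank -[\bot%O : T^d]/(\top%O : T) subnn.
have lt (x y : T^d) : (x < y)%O -> (dual_rank rho x < dual_rank rho y)%N.
  rewrite /dual_rank ltEdual => /(rank_lt hrank) yx.
  by have := rank_le hrank (lex1 (x : T)); lia.
rewrite (mul_toric_f lt) //.
rewrite /rank_poly; apply: eq_big => [s|s s_lt].
  by rewrite ltEdual -[\top%O : T^d]/(\bot%O : T) lt0x.
rewrite dual_rank_top toric_simplicial // ?mul1r.
  by rewrite /dual_rank subKn //; apply: (rank_le hrank); apply: lex1.
move=> q qs; have q0 : (q : T) != \bot%O.
  move: s_lt; rewrite ltEdual -[\top%O : T^d]/(\bot%O : T) -lt0x => /lt_le_trans.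
  by move: qs; rewrite leEdual => h; apply.
rewrite /dual_rank -(sum_upper_pow hrank hds q0) ?lex1 //.
apply: eq_big => [z|z]; first by rewrite leEdual lex1 andbT.
rewrite leEdual => /(rank_le hrank) qz; congr (_ ^+ _).
by have := rank_le hrank (lex1 (z : T)); lia.
Qed.

Lemma coef_rank_poly n i : rho \top%O = n.+1 -> (i <= n)%N ->
  (rank_poly rho)`_(n.+1 - i) = (toric_h (dual_rank rho))`_i
    - (if i is j.+1 then (toric_h (dual_rank rho))`_j else 0).
Proof.
move=> hn i_n; rewrite -mul_toric_f_dual ?hn // mulrBl mul1r coefB coefXM.
have hE j : (j <= n)%N ->
    (toric_h (dual_rank rho))`_j = (toric_f (dual_rank rho) \top%O)`_(n - j).
  by move=> jn; rewrite coef_poly dual_rank_top hn ltnS jn.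
rewrite subn_eq0 ltnNge i_n subSn //= hE //; congr (_ - _).
case: i i_n => [|i] i_n; last by rewrite hE 1?ltnW // -subSn.
(* For [i = 0] the coefficient of f in degree [n + 1] must vanish; the degree of f is bounded
   through that of [(X - 1) f]. *)
rewrite subn0 nth_default //.
have sz : (size (('X - 1) * toric_f (dual_rank rho) (\top%O : T^d))%R <= n.+2)%N.
  rewrite mul_toric_f_dual ?hn //; apply/leq_sizeP => k nk.
  rewrite coef_sum big1 // => s _; rewrite nth_default // size_exp_XsubC.
  by apply: leq_trans nk; rewrite ltnS -hn rank_le ?lex1.
have [->|f0] := eqVneq (toric_f (dual_rank rho) \top%O) 0; first by rewrite size_poly0.
by move: sz; rewrite size_monicM ?monicXsubC // size_XsubC.
Qed.

End Dual.

(** * Expansion of the short toric polynomial in the Boolean ones *)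

Theorem proposition6p7 (d : Order.disp_t) (T : finTBPOrderType d)
    (rho : T -> nat) (n : nat)
    (hrank : rank_function rho) (heul : eulerian rho)
    (hds : dual_simplicial T) (hn : rho \top%O = n.+1) :
  let h := toric_h (dual_rank rho) in
  short_toric rho =
    h`_0 *: boolean_short_toric n +
    \sum_(1 <= i < n./2.+1)
      (h`_i - h`_i.-1) *:
      \sum_(1 <= k < (minn i (n - i)).+1)
        ((n.+1%:R - 2 * i%:R) / k%:R * 'C(n - i, k.-1)%:R * 'C(i.-1, k.-1)%:R)
          *: boolean_short_toric (n - 2 * k).
Proof.
move=> h; set t := fun k => boolean_short_toric (n - 2 * k).
have gcoef i := @coef_rank_poly _ _ _ hrank hds n i hn; rewrite -/h in gcoef.
have -> : short_toric rho = \sum_(k < n./2.+1) (toric_g rho \top%O)`_k *: t k.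
  rewrite /short_toric hn; apply: short_of_toric_g => i i_n.
  by apply: toric_f_sum_g; rewrite hn.
transitivity (\sum_(i < n./2.+1) (rank_poly rho)`_(n.+1 - i) *:
    \sum_(k < n./2.+1) (nar (n.+1 - i) i)`_k *: t k).
  rewrite (toric_g_top hrank heul hds hn).
  under eq_bigr => k _ do rewrite coef_sum scaler_suml.
  rewrite exchange_big; apply: eq_bigr => i _; rewrite scaler_sumr.
  by apply: eq_bigr => k _; rewrite coefZ scalerA.
rewrite big_ord_recl; congr (_ + _).
  rewrite gcoef // subr0 subn0 nar0 big_ord_recl coef1 scale1r big1 ?addr0.
    by rewrite /t muln0 subn0.
  by move=> k _; rewrite coef1 scale0r.
rewrite big_add1 big_mkord; apply: eq_bigr => i _.
rewrite lift0; have i_n : (i.+1 <= n./2)%N by rewrite ltn_ord.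
rewrite gcoef; last by lia.
(* As [i + 1 <= n / 2], the minimum is always its first argument. *)
congr (_ *: _); have -> : minn i.+1 (n - i.+1) = i.+1 by lia.
rewrite big_ord_recl big_add1 big_mkord coef_nar.
have -> : (n.+1 - i.+1 = (n - i.+1).+1)%N by lia.
(* The constant term of [nar] is zero when both indices are positive, so [k] starts at 1. *)
rewrite {1}/nar_coef mulr0 mul0r subr0 scale0r add0r.
rewrite (big_ord_widen _ (fun k => ((n.+1%:R - 2 * i.+1%:R) / k.+1%:R
   * 'C(n - i.+1, k.+1.-1)%:R * 'C(i.+1.-1, k.+1.-1)%:R) *: t k.+1) i_n).
rewrite [RHS]big_mkcond /=.
apply: eq_bigr => k _; rewrite /bump add1n coef_nar nar_coefE.
(* Indices [k > i] only pad the sum: their binomial coefficient is zero. *)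
case: ltnP => ki; last by rewrite (@bin_small i k) ?mulr0 ?scale0r.
congr (_ *: _); congr (_ / _ * _ * _).
rewrite natrB; last by lia.
by rewrite -!natr1; ring.
Qed.
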